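(* Let $N,d\ge1$ be integers. For each $n=1,\dots,N$ let $p_n$ be a function from $\{s\in\mathbb Z_{\ge0}^d : s^1+\dots+s^d=n-1\}$ to the probability simplex $\Delta(\mathbf X)=\{(p^1,\dots,p^d): p^i\ge0,\ \sum_{i=1}^dp^i=1\}$, and consider the $N$-round multilabel classification game with neutral forecasting strategy $p_n=p_n(S_{n-1})$. Let $\eta$ be any real-valued function on $\{s\in\mathbb Z_{\ge0}^d : s^1+\dots+s^d=N\}$. Then the upper and lower expected values of $\eta(S_N)$ coincide and are given by $$\overline{\mathbb E}(\eta(S_N))=\underline{\mathbb E}(\eta(S_N))=\sum_{(x_1,\dots,x_N)\in\mathbf X^N}\left(\prod_{n=1}^Np_n(S_{n-1})^{x_n}\right)\eta(S_N),$$ where in each summand $S_n=x_1+\dots+x_n$ and $S_0=0$.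
   Context: $\mathbf X=\{e_1,\dots,e_d\}\subset\mathbb R^d$ is the set of standard coordinate vectors. For $p=(p^1,\dots,p^d)$ and $x=e_i\in\mathbf X$, the notation $p^{x}$ means $(p^1)^{x^1}\cdots(p^d)^{x^d}=p^i$ (with $0^0=1$). Multilabel classification game with neutral forecasting strategy: an initial capital $\mathcal K_0\in\mathbb R$ is given, and $S_0=0\in\mathbb R^d$. In each round $n=1,\dots,N$, Forecaster announces $p_n=p_n(S_{n-1})$; then Skeptic announces $M_n\in\mathbb R^d$; then Reality announces $x_n\in\mathbf X$; Skeptic's capital is updated by $\mathcal K_n=\mathcal K_{n-1}+M_n\cdot(x_n-p_n)$, where $\cdot$ is the standard inner product of $\mathbb R^d$, and $S_n=S_{n-1}+x_n$. A path is a sequence $\xi=x_1\dots x_N$ of Reality's moves. A strategy $\mathcal P$ of Skeptic specifies each $M_n$ as a function of Reality's previous moves $x_1,\dots,x_{n-1}$. $\mathcal K^{\mathcal P}_n(\xi)$ denotes Skeptic's capital after round $n$ along $\xi$ when he uses $\mathcal P$ with initial capital $0$. For a random variable, i.e. a real-valued function $x(\xi)$ of the path, $$\overline{\mathbb E}x=\inf\{\alpha\in\mathbb R \mid \exists\mathcal P\ \forall\xi:\ \mathcal K^{\mathcal P}_N(\xi)\ge x(\xi)-\alpha\},$$ $$\underline{\mathbb E}x=\sup\{\alpha\in\mathbb R \mid \exists\mathcal P\ \forall\xi:\ \mathcal K^{\mathcal P}_N(\xi)\ge \alpha-x(\xi)\}.$$ *)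

(* Defs.v *)
From HB Require Import structures.
From mathcomp Require Import all_boot all_order all_algebra.
From mathcomp Require Import boolp classical_sets reals constructive_ereal ereal.

Set Implicit Arguments.
Unset Strict Implicit.
Unset Printing Implicit Defensive.

Import Order.TTheory GRing.Theory Num.Theory.
Local Open Scope ring_scope.
Local Open Scope classical_set_scope.

(** A move of Reality is an element of X = {e_1, ..., e_d}.  It is encoded by
    its index [i : 'I_d]; [coord_vec i] is the vector itself. *)
Definition coord_vec (d : nat) (i : 'I_d) : 'rV[nat]_d := delta_mx 0 i.

Definition to_real (R : realType) (d : nat) (s : 'rV[nat]_d) : 'rV[R]_d :=
  map_mx (fun k : nat => k%:R) s.

Definition dotp (R : realType) (d : nat) (u v : 'rV[R]_d) : R :=
  \sum_(j < d) u 0 j * v 0 j.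

Definition mpow (R : realType) (d : nat) (p : 'rV[R]_d) (x : 'rV[nat]_d) : R :=
  \prod_(j < d) p 0 j ^+ (x 0 j).

Definition simplex (R : realType) (d : nat) : set 'rV[R]_d :=
  [set p : 'rV[R]_d | (forall j, 0 <= p 0 j) /\ \sum_(j < d) p 0 j = 1].

Definition lattice (d k : nat) : set 'rV[nat]_d :=
  [set s : 'rV[nat]_d | \sum_(j < d) s 0 j = k].

(** The vector S_n = x_1 + ... + x_n reached after the moves [h = x_1 ... x_n]. *)
Definition state (d : nat) (h : seq 'I_d) : 'rV[nat]_d :=
  \sum_(i <- h) coord_vec i.

(** [p n s] is the forecast p_n(s) of round n, rounds being numbered from 1. *)
Definition forecasting (R : realType) (d : nat) := nat -> 'rV[nat]_d -> 'rV[R]_d.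

(** Only the values of p_1, ..., p_N at the points s with s^1 + ... + s^d = n - 1
    are constrained: these are the only ones the game uses. *)
Definition neutral_forecasting (R : realType) (d N : nat)
    (p : forecasting R d) : Prop :=
  forall n : nat, (1 <= n <= N)%N ->
  forall s : 'rV[nat]_d, lattice n.-1 s -> simplex (p n s).

(** The move M_n of Skeptic is [P h], where [h = x_1 ... x_(n-1)]; the round
    number is recovered as [(size h).+1]. *)
Definition strategy (R : realType) (d : nat) := seq 'I_d -> 'rV[R]_d.

(** [capital_from p P K h l] is the capital of Skeptic after the moves [h ++ l]
    when it equals [K] after the moves [h]. *)
Fixpoint capital_from (R : realType) (d : nat) (p : forecasting R d)
    (P : strategy R d) (K : R) (h l : seq 'I_d) {struct l} : R :=
  if l is x :: l' then
    capital_from p P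
      (K + dotp (P h) (to_real R (coord_vec x) - p (size h).+1 (state h)))
      (rcons h x) l'
  else K.

Definition capital (R : realType) (d : nat) (p : forecasting R d) (K0 : R)
    (P : strategy R d) (xi : seq 'I_d) : R :=
  capital_from p P K0 [::] xi.

(** The infimum and supremum are taken in the extended reals, so that an empty
    or unbounded set does not get a conventional real value. *)
Definition upper_expectation (R : realType) (d N : nat) (p : forecasting R d)
    (x : N.-tuple 'I_d -> R) : \bar R :=
  ereal_inf [set a%:E | a in [set a : R | exists P : strategy R d,
    forall xi : N.-tuple 'I_d, capital p 0 P xi >= x xi - a]].

Definition lower_expectation (R : realType) (d N : nat) (p : forecasting R d)
    (x : N.-tuple 'I_d -> R) : \bar R :=
  ereal_sup [set a%:E | a in [set a : R | exists P : strategy R d,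
    forall xi : N.-tuple 'I_d, capital p 0 P xi >= a - x xi]].

(** The factor of index [n : 'I_N] is that of round n + 1. *)
Definition path_weight (R : realType) (d N : nat) (p : forecasting R d)
    (xi : N.-tuple 'I_d) : R :=
  \prod_(n < N) mpow (p n.+1 (state (take n xi))) (coord_vec (tnth xi n)).

(* Main.v *)
Require Import Defs.
From HB Require Import structures.
From mathcomp Require Import all_boot all_order all_algebra.
From mathcomp Require Import boolp classical_sets reals constructive_ereal ereal.

Set Implicit Arguments.
Unset Strict Implicit.
Unset Printing Implicit Defensive.

Import Order.TTheory GRing.Theory Num.Theory.
Local Open Scope ring_scope.

(** The forecasts are the conditional probabilities of a process whose
    conditional expectation of a payoff is given by backward recursion.
    Betting at each history the vector of the next conditional expectations
    replicates the payoff exactly, starting from its expectation.  Conversely,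
    the capital of any strategy is a martingale for this process, so no
    smaller initial capital can superreplicate the payoff. *)

Lemma sum_cons_tuple (R : nmodType) (T : finType) (n : nat)
    (F : n.+1.-tuple T -> R) :
  \sum_(t : n.+1.-tuple T) F t =
    \sum_(x : T) \sum_(t : n.-tuple T) F [tuple of x :: t].
Proof.
rewrite pair_big /=.
rewrite (reindex (fun z : T * n.-tuple T => [tuple of z.1 :: z.2])) //=.
exists (fun t : n.+1.-tuple T => (thead t, [tuple of behead t])) => [[x t] _|t _] /=.
  by congr pair; apply: val_inj.
by rewrite [RHS]tuple_eta; apply: val_inj.
Qed.

(** Each move adds one unit to a single coordinate. Hence every reachable state lies where
    [neutral_forecasting] guarantees a probability vector. *)
Lemma state_lattice (d : nat) (h : seq 'I_d) : lattice (size h) (state h).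
Proof.
rewrite /lattice /= /state; elim: h => [|i h IH].
  by rewrite big_nil big1 // => j _; rewrite mxE.
have coord_sum : \sum_(j < d) coord_vec i 0 j = 1%N.
  rewrite (bigD1 i) //= mxE !eqxx /= big1 // => j /negPf ji.
  by rewrite mxE ji andbF.
by rewrite big_cons; under eq_bigr do rewrite mxE; rewrite big_split /= coord_sum IH.
Qed.

Lemma mpow_coord_vec (R : realType) (d : nat) (q : 'rV[R]_d) (i : 'I_d) :
  mpow q (coord_vec i) = q 0 i.
Proof.
rewrite /mpow (bigD1 i) //= big1 ?mulr1 => [|j /negPf ji].
  by rewrite mxE !eqxx expr1.
by rewrite mxE ji andbF expr0.
Qed.

Lemma dotp_coord_vecB (R : realType) (d : nat) (M q : 'rV[R]_d) (i : 'I_d) :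
  dotp M (to_real R (coord_vec i) - q) = M 0 i - \sum_(j < d) q 0 j * M 0 j.
Proof.
rewrite /dotp.
under eq_bigr do rewrite !mxE mulrBr.
rewrite sumrB; congr (_ - _); last by apply: eq_bigr => j _; rewrite mulrC.
rewrite (bigD1 i) //= !eqxx mulr1 big1 ?addr0 // => j /negPf ->.
by rewrite mulr0.
Qed.

(** [capital_from] consumes a path from its front; the martingale argument needs the update at its
    last move. *)
Lemma capital_from_rcons (R : realType) (d : nat) (p : forecasting R d)
    (P : strategy R d) (K : R) (h l : seq 'I_d) (x : 'I_d) :
  capital_from p P K h (rcons l x) = capital_from p P K h l +
    dotp (P (h ++ l)) (to_real R (coord_vec x) - p (size (h ++ l)).+1 (state (h ++ l))).
Proof.
by elim: l K h => [|y l IH] K h /=; rewrite ?cats0 // IH cat_rcons.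
Qed.

(** Expected value of [f (h ++ l)] when the [k] moves [l] that follow [h] are
    drawn from the forecasts. *)
Fixpoint cond_exp (R : realType) (d : nat) (p : forecasting R d)
    (f : seq 'I_d -> R) (k : nat) (h : seq 'I_d) : R :=
  if k is k'.+1 then
    \sum_(i < d) p (size h).+1 (state h) 0 i * cond_exp p f k' (rcons h i)
  else f h.

Lemma cond_expN (R : realType) (d : nat) (p : forecasting R d)
    (f : seq 'I_d -> R) (k : nat) (h : seq 'I_d) :
  cond_exp p (fun l => - f l) k h = - cond_exp p f k h.
Proof.
elim: k h => //= k IH h; rewrite -sumrN.
by apply: eq_bigr => i _; rewrite IH mulrN.
Qed.

Lemma cond_exp_sum (R : realType) (d : nat) (p : forecasting R d)
    (f : seq 'I_d -> R) (k : nat) (h : seq 'I_d) :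
  cond_exp p f k h = \sum_(xi : k.-tuple 'I_d)
    (\prod_(n < k) mpow (p (size h + n).+1 (state (h ++ take n xi)))
       (coord_vec (tnth xi n))) * f (h ++ xi).
Proof.
elim: k h => [|k IH] h.
  rewrite (big_pred1 [tuple]) => [|t]; last by rewrite [t]tuple0 /= eqxx.
  by rewrite big_ord0 mul1r /= cats0.
rewrite sum_cons_tuple /=; apply: eq_bigr => i _.
rewrite IH mulr_sumr; apply: eq_bigr => t _.
rewrite big_ord_recl /= cats0 addn0 mpow_coord_vec -mulrA cat_rcons.
congr (_ * (_ * _)); apply: eq_bigr => n _.
by rewrite size_rcons cat_rcons addSnnS tnthS.
Qed.

Lemma cond_exp_path_weight (R : realType) (d N : nat) (p : forecasting R d)
    (f : seq 'I_d -> R) :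
  cond_exp p f N [::] = \sum_(xi : N.-tuple 'I_d) path_weight p xi * f xi.
Proof. exact: cond_exp_sum. Qed.

(** The stake on label [i] is the expectation of [f] once [i] has occurred, with [N - (size h).+1]
    rounds left. The subtraction truncates only at histories too long to be played from. *)
Definition hedge (R : realType) (d N : nat) (p : forecasting R d)
    (f : seq 'I_d -> R) : strategy R d :=
  fun h => \row_i cond_exp p f (N - (size h).+1) (rcons h i).

(** A round's gain is the new conditional expectation minus the old one, so the gains telescope to
    the payoff minus the starting expectation. *)
Lemma capital_from_hedge (R : realType) (d N : nat) (p : forecasting R d)
    (f : seq 'I_d -> R) (K : R) (h l : seq 'I_d) :
  (size h + size l = N)%N ->
  capital_from p (hedge N p f) K h l = K + f (h ++ l) - cond_exp p f (size l) h.
Proof.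
elim: l K h => [|x l IH] K h /= hN; first by rewrite cats0 addrK.
have hedgeE i : hedge N p f h 0 i = cond_exp p f (size l) (rcons h i).
  by rewrite mxE -hN addnS subSS addKn.
rewrite IH ?size_rcons ?addSnnS // cat_rcons dotp_coord_vecB hedgeE.
under [in LHS]eq_bigr do rewrite hedgeE.
(* The mean stake is now the recursive form of [cond_exp] at [h], and the two expectations at
   [rcons h x] cancel. *)
by rewrite -!addrA; congr (K + _); rewrite addrC -!addrA addNr addr0 addrC.
Qed.

Lemma capital_hedge (R : realType) (d N : nat) (p : forecasting R d)
    (f : seq 'I_d -> R) (xi : N.-tuple 'I_d) :
  capital p 0 (hedge N p f) xi = f xi - cond_exp p f N [::].
Proof. by rewrite /capital capital_from_hedge ?size_tuple //= add0r. Qed.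

(** Backward induction: averaging with nonnegative weights of total mass 1 preserves inequalities,
    fixes [a], and takes the next capitals to the present one. *)
Lemma cond_exp_le_capital (R : realType) (d N : nat) (p : forecasting R d)
    (P : strategy R d) (f : seq 'I_d -> R) (a : R) (k : nat) (h : seq 'I_d) :
  neutral_forecasting N p -> (size h + k = N)%N ->
  (forall l, size l = k -> f (h ++ l) - a <= capital p 0 P (h ++ l)) ->
  cond_exp p f k h - a <= capital p 0 P h.
Proof.
move=> hp; elim: k h => [|k IH] h hN fK /=; first by have := fK [::] erefl; rewrite cats0.
have [q0 q1] : simplex (p (size h).+1 (state h)).
  apply: hp; last exact: state_lattice.
  by rewrite -hN addnS /= ltnS leq_addr.
set q := p _ _ in q0 q1 *.
have mart : \sum_(i < d) q 0 i * capital p 0 P (rcons h i) = capital p 0 P h.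
  rewrite /capital; under eq_bigr do
    rewrite capital_from_rcons /= dotp_coord_vecB -/q addrCA mulrDr.
  by rewrite big_split /= -mulr_suml q1 mul1r addrCA subrr addr0.
(* With [a] and the capital both written as [q]-averages, the inequality can be checked label by
   label. *)
rewrite -mart -[a]mul1r -q1 mulr_suml -sumrB; apply: ler_sum => i _.
rewrite -mulrBr ler_wpM2l //; apply: IH => [|l ls].
  by rewrite size_rcons addSnnS.
by rewrite cat_rcons; apply: fK; rewrite /= ls.
Qed.

Lemma cond_exp_le_price (R : realType) (d N : nat) (p : forecasting R d)
    (P : strategy R d) (f : seq 'I_d -> R) (a : R) :
  neutral_forecasting N p ->
  (forall xi : N.-tuple 'I_d, f xi - a <= capital p 0 P xi) ->
  cond_exp p f N [::] <= a.
Proof.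
move=> hp fK; rewrite -subr_le0.
(* At the empty history the capital is the initial 0. *)
apply: (cond_exp_le_capital (P := P) hp) => // l /eqP ls.
exact: (fK (Tuple ls)).
Qed.

(** Replication is exact, so the infimum is attained by [hedge]. *)
Lemma upper_expectationE (R : realType) (d N : nat) (p : forecasting R d)
    (f : seq 'I_d -> R) : neutral_forecasting N p ->
  upper_expectation p (fun xi : N.-tuple 'I_d => f xi) = (cond_exp p f N [::])%:E.
Proof.
move=> hp; apply/eqP; rewrite eq_le; apply/andP; split.
  apply: ereal_inf_lbound; exists (cond_exp p f N [::]) => //.
  by exists (hedge N p f) => xi; rewrite capital_hedge.
apply: le_ereal_inf_tmp => _ [a [P fK] <-].
by rewrite lee_fin; exact: (cond_exp_le_price hp fK).
Qed.

Lemma lower_expectationE (R : realType) (d N : nat) (p : forecasting R d)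
    (f : seq 'I_d -> R) : neutral_forecasting N p ->
  lower_expectation p (fun xi : N.-tuple 'I_d => f xi) = (cond_exp p f N [::])%:E.
Proof.
move=> hp; apply/eqP; rewrite eq_le; apply/andP; split.
  apply: ge_ereal_sup => _ [a [P fK] <-].
  (* Securing [a - f] amounts to superreplicating [- f] at price [- a], which reduces the bound to
     the upper case. *)
  rewrite lee_fin -lerN2 -cond_expN; apply: (cond_exp_le_price (P := P) hp) => xi.
  by rewrite opprK addrC; exact: fK.
apply: ereal_sup_ubound; exists (cond_exp p f N [::]) => //.
exists (hedge N p (fun l => - f l)) => xi.
by rewrite capital_hedge cond_expN opprK addrC.
Qed.

Theorem theorem6p1 (R : realType) (N d : nat) (hN : (1 <= N)%N) (hd : (1 <= d)%N)
    (p : forecasting R d) (hp : neutral_forecasting N p)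
    (eta : 'rV[nat]_d -> R) :
  upper_expectation p (fun xi : N.-tuple 'I_d => eta (state xi)) =
    lower_expectation p (fun xi : N.-tuple 'I_d => eta (state xi)) /\
  lower_expectation p (fun xi : N.-tuple 'I_d => eta (state xi)) =
    (\sum_(xi : N.-tuple 'I_d) path_weight p xi * eta (state xi))%:E.
Proof.
have up := upper_expectationE (fun l => eta (state l)) hp.
have lo := lower_expectationE (fun l => eta (state l)) hp.
by split; [rewrite up lo | rewrite lo cond_exp_path_weight].
Qed.
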